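(* Let $K\ge 0$ be a known integer and $\sigma^2>0$ be known, and let $Y\sim \mathsf{N}_n(\theta^\star,\sigma^2 I_n)$, where $\theta^\star$ has a piecewise degree-$K$ polynomial structure. Let $\pi^n$ be the marginal posterior distribution for the block configuration $B$ defined in the context, with prior constant $\lambda>0$. Then for any $C>1+\lambda^{-1}$ there exists a constant $G>0$ such that $$\mathsf{E}_{\theta^\star}\,\pi^n(\{B:\ |B|>C|B_{\theta^\star}|\})\ \lesssim\ e^{-G|B_{\theta^\star}|\log n}$$ for all large $n$, uniformly in $\theta^\star\in\Theta_n(K)$.
   Context: The notation $a\lesssim b$ means $a\le C_0 b$ for a constant $C_0>0$ not depending on $n$ or $\theta^\star$; ''for all large $n$, uniformly in $\theta^\star$'' means that $C_0$, $G$ and the threshold on $n$ do not depend on $\theta^\star$. Piecewise polynomials: a simple partition (block configuration) $B$ of $\{1,\dots,n\}$ is a partition into nonempty blocks of consecutive indices $B(1),\dots,B(|B|)$; $|B|$ is the number of blocks. A vector $\theta\in\mathbb{R}^n$ has a piecewise degree-$K$ polynomial structure with respect to $B$ if, for each $s$, the sub-vector $(\theta_j)_{j\in B(s)}$ is given by a polynomial of degree at most $K$ in $j$. $B_\theta$ denotes a most economical (smallest number of blocks) such $B$; $|B_\theta|$ is its number of blocks (well defined even if $B_\theta$ is not unique). $\Theta_n(K)$ is the set of all $\theta\in\mathbb{R}^n$ with a piecewise degree-$K$ polynomial structure and $|B_\theta|=o(n)$, i.e. $|B_\theta|\le b_n$ for a fixed sequence $b_n$ with $b_n/n\to0$. Prior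 for $B$: $\pi_n(B)=\binom{n-1}{|B|-1}^{-1}f_n(|B|)$ over all simple partitions $B$ of $\{1,\dots,n\}$, where $f_n(b)\propto n^{-\lambda(b-1)}$, $b=1,\dots,n$, is a probability mass function and $\lambda>0$ is a constant. Marginal posterior for $B$: fix constants $v>0$, $\alpha\in(0,1)$. Let $Z\in\mathbb{R}^{n\times(K+1)}$ be a matrix whose columns form a basis of $\mathrm{span}\{v_0,\dots,v_K\}$, $v_k=(1^k,\dots,n^k)^\top$; let $Z_{B(s)}$ be its sub-matrix with row indices in $B(s)$, $P_{B(s)}$ the orthogonal projection onto the column space of $Z_{B(s)}$ (that is, $Z_{B(s)}\{Z_{B(s)}^\top Z_{B(s)}\}^{-1}Z_{B(s)}^\top$), and $Y_{B(s)}$ the sub-vector of $Y$ with indices in $B(s)$. Then $\pi^n$ is the probability distribution on simple partitions with $$\pi^n(B)\ \propto\ \pi_n(B)\Big(1+\frac{v\alpha}{\sigma^2}\Big)^{-(K+1)|B|/2}\exp\Big\{-\frac{\alpha}{2\sigma^2}\sum_{s=1}^{|B|}\|(I-P_{B(s)})Y_{B(s)}\|_2^2\Big\}.$$ $\mathsf{E}_{\theta^\star}$ is expectation over $Y\sim\mathsf{N}_n(\theta^\star,\sigma^2I_n)$. *)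

(* Defs.v *)
From HB Require Import structures.
From mathcomp Require Import all_boot all_order all_algebra.
From mathcomp Require Import all_classical all_reals all_analysis.

Set Implicit Arguments.
Unset Strict Implicit.
Unset Printing Implicit Defensive.

Import Order.TTheory GRing.Theory Num.Theory.
Import numFieldNormedType.Exports.

Local Open Scope ring_scope.

(* The index set {1, ..., n} is ['I_n]: the ordinal [j] stands for the index
   j + 1. *)

Section Partitions.
Variable n : nat.
Implicit Types (S : {set 'I_n}) (B : {set {set 'I_n}}).

Definition consecutive S :=
  [forall i in S, forall k in S, forall j : 'I_n, (i <= j <= k)%N ==> (j \in S)].

(* [finset.partition] already requires the blocks to be nonempty and disjoint. *)
Definition simple_partition B :=
  finset.partition B [set: 'I_n] && [forall S in B, consecutive S].

End Partitions.

Section PiecewisePolynomials.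
Variables (R : realType) (K n : nat).
Implicit Types (theta : 'cV[R]_n) (B : {set {set 'I_n}}).

Definition piecewise_poly B theta :=
  forall S, S \in B -> exists p : {poly R},
    (size p <= K.+1)%N /\ forall j, j \in S -> theta j 0 = p.[j.+1%:R].

(* [B] is a legitimate choice of B_theta; such a [B] always exists, since the
   partition into singletons is piecewise polynomial. *)
Definition most_economical theta B :=
  [/\ simple_partition B, piecewise_poly B theta &
      forall B', simple_partition B' -> piecewise_poly B' theta ->
        (#|B| <= #|B'|)%N].

Definition Theta (b : R) theta :=
  exists2 B, most_economical theta B & #|B|%:R <= b.

End PiecewisePolynomials.

Section OrthogonalProjection.
Variables (R : realType) (m p : nat).

(* [proj_mx] acts on row vectors and [kermx A] is the orthogonal complement of
   the column space of [A] (both seen as spaces of rows), whence the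
   transpositions.  No rank condition is needed: blocks shorter than K + 1 give
   a singular Gram matrix. *)
Definition orth_proj (A : 'M[R]_(m, p)) : 'M[R]_m :=
  (proj_mx <<A^T>>%MS (kermx A))^T.

Definition sqnorm (u : 'cV[R]_m) : R := \sum_i u i 0 ^+ 2.

End OrthogonalProjection.

Section OrthogonalProjectionTheory.
Variables (R : realType) (m p : nat).
Implicit Type A : 'M[R]_(m, p).

Lemma gram_col_eq0 (u : 'cV[R]_m) : u^T *m u = 0 -> u = 0.
Proof.
move/matrixP/(_ 0 0); rewrite !mxE => /eqP; rewrite psumr_eq0.
  move=> /allP u0; apply/colP => i; rewrite !mxE.
  have := u0 i (mem_index_enum _); rewrite !mxE /= mulf_eq0 orbb.
  by move/eqP.
by move=> i _; rewrite !mxE -expr2 sqr_ge0.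
Qed.

Lemma col_ker_disj A : (<<A^T>> :&: kermx A = 0)%MS.
Proof.
apply/eqP/rowV0P => u; rewrite sub_capmx genmxE => /andP[/submxP[w uE]].
move/sub_kermxP => uA; apply: trmx_inj; rewrite trmx0; apply: gram_col_eq0.
by rewrite trmxK {2}uE trmx_mul trmxK mulmxA uA mul0mx.
Qed.

Lemma col_ker_full A : (1%:M <= <<A^T>> + kermx A)%MS.
Proof.
rewrite sub1mx /row_full mxrank_disjoint_sum ?col_ker_disj //.
by rewrite mxrank_gen mxrank_tr mxrank_ker subnKC ?rank_leq_row.
Qed.

Lemma orth_proj_id A : orth_proj A *m A = A.
Proof.
apply: trmx_inj; rewrite trmx_mul trmxK proj_mx_id ?col_ker_disj //.
by rewrite genmxE.
Qed.

Lemma orth_proj_sub A : ((orth_proj A)^T <= A^T)%MS.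
Proof.
rewrite trmxK -[X in (X <= _)%MS]mul1mx -(genmxE A^T); exact: proj_mx_sub.
Qed.

Lemma orth_proj_sym A : (orth_proj A)^T = orth_proj A.
Proof.
have /submxP[W PE] := orth_proj_sub A.
have AP : A^T *m orth_proj A = A^T.
  have := proj_mx_compl_sub (col_ker_full A).
  rewrite mul1mx => /sub_kermxP; rewrite mulmxBl mul1mx => /subr0_eq PA.
  by rewrite /orth_proj -trmx_mul -PA.
have PP : (orth_proj A)^T *m orth_proj A = (orth_proj A)^T.
  by rewrite PE -mulmxA AP.
by rewrite -[in RHS](trmxK (orth_proj A)) -PP trmx_mul trmxK.
Qed.

Lemma orth_proj_idem A : orth_proj A *m orth_proj A = orth_proj A.
Proof.
have /submxP[W PE] := orth_proj_sub A.
have -> : orth_proj A = A *m W^T by rewrite -[LHS]trmxK PE trmx_mul trmxK.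
by rewrite {1}[A *m _](_ : _ = orth_proj A) ?mulmxA ?orth_proj_id //
           -[RHS]trmxK PE trmx_mul trmxK.
Qed.

Lemma orth_projE A : A^T *m A \in unitmx ->
  orth_proj A = A *m invmx (A^T *m A) *m A^T.
Proof.
move=> uA; have /submxP[W PE] := orth_proj_sub A.
rewrite orth_proj_sym in PE.
have WA : W *m (A^T *m A) = A by rewrite mulmxA -PE orth_proj_id.
have -> : A *m invmx (A^T *m A) = W by rewrite -{1}WA mulmxK.
exact: PE.
Qed.

End OrthogonalProjectionTheory.

Section MarginalPosterior.
Variables (R : realType) (n : nat).
Implicit Types (B : {set {set 'I_n}}) (S : {set 'I_n}).

Definition block_number_pmf (lambda : R) (b : nat) : R :=
  n%:R `^ (- lambda * b.-1%:R)
  / \sum_(1 <= b' < n.+1) n%:R `^ (- lambda * b'.-1%:R).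

Definition block_prior (lambda : R) B : R :=
  'C(n.-1, #|B|.-1)%:R^-1 * block_number_pmf lambda #|B|.

Definition design (K : nat) : 'M[R]_(n, K.+1) :=
  \matrix_(j, k) j.+1%:R ^+ k.

(* Columns are transposed into rows: the columns of [Z] are linearly
   independent and span the same space as those of [design K]. *)
Definition design_basis (K : nat) (Z : 'M[R]_(n, K.+1)) :=
  row_free Z^T && (Z^T == (design K)^T)%MS.

Definition sub_rows (q : nat) (A : 'M[R]_(n, q)) S : 'M[R]_(#|S|, q) :=
  rowsub enum_val A.

Definition residual (K : nat) (Z : 'M[R]_(n, K.+1)) (y : 'cV[R]_n) B : R :=
  \sum_(S in B)
    sqnorm ((1%:M - orth_proj (sub_rows Z S)) *m sub_rows y S).

Definition posterior_weight (K : nat) (lambda v alpha sigma : R)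
    (Z : 'M[R]_(n, K.+1)) (y : 'cV[R]_n) B : R :=
  block_prior lambda B
  * (1 + v * alpha / sigma ^+ 2) `^ (- (K.+1 * #|B|)%:R / 2)
  * expR (- (alpha / (2 * sigma ^+ 2)) * residual Z y B).

Definition posterior (K : nat) (lambda v alpha sigma : R)
    (Z : 'M[R]_(n, K.+1)) (y : 'cV[R]_n) (E : pred {set {set 'I_n}}) : R :=
  (\sum_(B | simple_partition B && E B)
     posterior_weight lambda v alpha sigma Z y B)
  / \sum_(B | simple_partition B) posterior_weight lambda v alpha sigma Z y B.

End MarginalPosterior.

Local Open Scope classical_set_scope.

Section GaussianVector.
Context d (T : measurableType d) (R : realType) (P : probability T R).

Definition mutually_independent (I : finType) (X : I -> {RV P >-> R}) :=
  forall (J : {set I}) (A : I -> set R), (forall i, measurable (A i)) ->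
    P (\bigcap_(i in [set` J]) (X i @^-1` A i))
    = (\prod_(i in J) P (X i @^-1` A i))%E.

(* N_n(theta, sigma^2 I_n): independent normal coordinates; the second
   parameter of [normal_prob] is the standard deviation. *)
Definition isotropic_gaussian (n : nat) (theta : 'cV[R]_n) (sigma : R)
    (Y : 'I_n -> {RV P >-> R}) :=
  mutually_independent Y /\
  forall i (A : set R), measurable A ->
    distribution P (Y i) A = normal_prob (theta i 0) sigma A.

End GaussianVector.

(* Main.v *)
(* Bounding the normalizing constant below by the weight of B_theta alone, the
   posterior mass is at most the sum of the ratios weight(B) / weight(B_theta).
   Let Pi_B be the projection on the piecewise polynomials with respect to B,
   and Q the projection on the range of (1 - Pi_{B_theta}) Pi_B, of rank at most
   (K + 1) |B|.  Since Q kills theta, the residual of B_theta exceeds that of B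
   by at most |Q (Y - theta)|^2, and a Gaussian computation gives
   E exp (alpha |Q (Y - theta)|^2 / (2 sigma^2)) <= A^|B| with
   A = (1 - alpha)^(-(K + 1) / 2).  A simple partition is determined by the set
   of the first indices of its blocks, so there are at most binom(n - 1, b - 1)
   partitions with b blocks; this cancels the uniform part of the prior.  With
   b0 = |B_theta| there remains
   n^(b0 - 1) sum_(b > C b0) n^(- lambda (b - b0)) A^b, and each term is at most
   n^(lambda b0) (A n^(- lambda))^(C b0), where C lambda > 1 + lambda. *)

Require Import Defs.
From HB Require Import structures.
From mathcomp Require Import all_boot all_order all_algebra.
From mathcomp Require Import all_classical all_reals all_analysis.
From mathcomp Require Import measurable_realfun ring lra.

Set Implicit Arguments.
Unset Strict Implicit.
Unset Printing Implicit Defensive.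

Import Order.TTheory GRing.Theory Num.Theory.
Import numFieldNormedType.Exports.

Local Open Scope ring_scope.

(** * Orthogonal projections *)

Section Projections.
Context {R : realType}.

Lemma sqnormE {m} (u : 'cV[R]_m) : sqnorm u = (u^T *m u) 0 0.
Proof. by rewrite /sqnorm !mxE; apply: eq_bigr => i _; rewrite !mxE expr2. Qed.

Lemma sqnorm_ge0 {m} (u : 'cV[R]_m) : 0 <= sqnorm u.
Proof. by apply: sumr_ge0 => i _; exact: sqr_ge0. Qed.

Lemma sqnorm_eq0 {m} (u : 'cV[R]_m) : sqnorm u = 0 -> u = 0.
Proof.
move=> u0; apply: gram_col_eq0; apply/matrixP => i j.
by rewrite !ord1 -sqnormE u0 mxE.
Qed.

Definition is_proj {m} (Q : 'M[R]_m) := Q^T = Q /\ Q *m Q = Q.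

Lemma is_proj_orth_proj {m p} (A : 'M[R]_(m, p)) : is_proj (orth_proj A).
Proof. by split; [exact: orth_proj_sym|exact: orth_proj_idem]. Qed.

Lemma is_projC {m} (Q : 'M[R]_m) : is_proj Q -> is_proj (1%:M - Q).
Proof.
move=> [QT QQ]; split; first by rewrite linearB/= trmx1 QT.
by rewrite mulmxBl mul1mx mulmxBr mulmx1 QQ subrr subr0.
Qed.

Lemma sqnorm_proj {m} (Q : 'M[R]_m) (u : 'cV[R]_m) : is_proj Q ->
  sqnorm (Q *m u) = (u^T *m Q *m u) 0 0.
Proof. by move=> [QT QQ]; rewrite sqnormE trmx_mul QT !mulmxA -(mulmxA u^T Q
  Q) QQ. Qed.

Lemma sqnorm_proj_le {m} (Q : 'M[R]_m) (u : 'cV[R]_m) : is_proj Q ->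
  sqnorm (Q *m u) <= sqnorm u.
Proof.
move=> Qp; have := sqnorm_ge0 ((1%:M - Q) *m u).
rewrite !sqnorm_proj//; last exact: is_projC.
by rewrite mulmxBr mulmx1 mulmxBl mxE [X in _ + X]mxE -sqnormE subr_ge0.
Qed.

(** A nonzero column of [Q] is fixed by [Q]; normalised, it gives [u]. The difference kills [u],
    which [Q] fixes, so the rank drops strictly. This permits induction on the rank without
    diagonalising [Q]. *)
Lemma is_proj_peel {m} (Q : 'M[R]_m) : is_proj Q -> Q != 0 ->
  exists u : 'cV[R]_m, [/\ sqnorm u = 1, Q *m u = u,
    is_proj (Q - u *m u^T) & (\rank (Q - u *m u^T)%R < \rank Q)%N].
Proof.
move=> [QT QQ] Q0.
have [j qj0] : exists j, col j Q != 0.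
  apply/existsP; rewrite -negb_forall; apply: contra Q0 => /forallP Q0.
  by apply/eqP/matrixP => i j; move/eqP: (Q0 j) => /colP/(_ i); rewrite !mxE.
set q := col j Q in qj0.
have Qq : Q *m q = q by rewrite /q colE mulmxA QQ.
have q0 : 0 < sqnorm q.
  by rewrite lt_def sqnorm_ge0 andbT; apply: contra qj0 => /eqP/sqnorm_eq0 ->.
pose u := (Num.sqrt (sqnorm q))^-1 *: q.
have Qu : Q *m u = u by rewrite /u -scalemxAr Qq.
have u1 : sqnorm u = 1.
  rewrite /u /sqnorm; under eq_bigr do rewrite mxE exprMn.
  by rewrite -mulr_sumr exprVn sqr_sqrtr ?ltW// mulVf// gt_eqF.
have uu : u^T *m u = 1%:M.
  by apply/matrixP => a b; rewrite !ord1 -sqnormE u1 mxE.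
have uQ : u^T *m Q = u^T by rewrite -[in LHS]QT -trmx_mul Qu.
have Q'p : is_proj (Q - u *m u^T).
  split; first by rewrite linearB/= trmx_mul trmxK QT.
  rewrite mulmxBl !mulmxBr QQ mulmxA Qu -(mulmxA u) uQ.
  by rewrite -(mulmxA u) (mulmxA u^T) uu mul1mx subrr subr0.
exists u; split => //; apply: rank_ltmx; rewrite ltmxE.
have Q'Q : (Q - u *m u^T) *m Q = Q - u *m u^T.
  by rewrite mulmxBl QQ -mulmxA uQ.
apply/andP; split; first by rewrite -Q'Q submxMl.
apply/negP => /submxP[D QD].
have : u^T *m u = 0.
  rewrite -{1}uQ QD -!mulmxA mulmxBl Qu -(mulmxA u) uu mulmx1 subrr.
  by rewrite !mulmx0.
by rewrite uu => /matrixP/(_ 0 0)/eqP; rewrite !mxE oner_eq0.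
Qed.

(** [Q] projects on the part of the range of [P1] that sticks out of the range of [P2]. Then
    [P2 + Q] is a projection whose range contains both ranges, and Pythagoras splits the residual of
    [P2] into the [Q] part and a residual no larger than that of [P1]. *)
Lemma proj_join_excess {m} (P1 P2 : 'M[R]_m) : is_proj P1 -> is_proj P2 ->
  exists Q : 'M[R]_m, [/\ is_proj Q, Q *m P2 = 0, (\rank Q <= \rank P1)%N &
    forall y, sqnorm ((1%:M - P2) *m y) - sqnorm ((1%:M - P1) *m y)
              <= sqnorm (Q *m y)].
Proof.
move=> P1p P2p; have [P1T P11] := P1p; have [P2T P22] := P2p.
pose M := (1%:M - P2) *m P1; pose Q := orth_proj M.
have Qp : is_proj Q by exact: is_proj_orth_proj.
have [QT QQ] := Qp.
have P2M : P2 *m M = 0 by rewrite /M mulmxA mulmxBr mulmx1 P22 subrr mul0mx.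
have [D QD] : exists D, Q = M *m D.
  have /submxP[D /(congr1 trmx)] := orth_proj_sub M.
  by rewrite trmxK trmx_mul trmxK; exists D^T.
have P2Q : P2 *m Q = 0 by rewrite QD mulmxA P2M mul0mx.
have QP2 : Q *m P2 = 0 by rewrite -QT -P2T -trmx_mul P2Q trmx0.
(* [P1] is [P2 *m P1 + M], and [Q] fixes [M]. *)
have QP1 : (P2 + Q) *m P1 = P1.
  have : Q *m M = M by exact: orth_proj_id.
  rewrite /M mulmxA mulmxBr mulmx1 QP2 subr0 mulmxBl mul1mx mulmxDl => ->.
  by rewrite addrC subrK.
have P2Qp : is_proj (P2 + Q).
  split; first by rewrite linearD/= P2T QT.
  by rewrite mulmxDl !mulmxDr P22 QQ P2Q QP2 addr0 add0r.
exists Q; split => //.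
  rewrite QD (leq_trans (mxrankM_maxl _ _))// /M.
  exact: mxrankM_maxr.
move=> y; rewrite lerBlDr.
have -> : sqnorm ((1%:M - P2) *m y) =
    sqnorm (Q *m y) + sqnorm ((1%:M - (P2 + Q)) *m y).
  rewrite !sqnorm_proj//; [|exact: is_projC..].
  rewrite (_ : 1%:M - P2 = Q + (1%:M - (P2 + Q))).
    by rewrite [in LHS]mulmxDr [in LHS]mulmxDl mxE.
  by rewrite opprD [X in _ = _ + X]addrA [RHS]addrC subrK.
rewrite lerD2l.
(* The complement of [P2 + Q] kills [P1], hence factors through the complement of [P1]; projections
   are contractions. *)
have -> : 1%:M - (P2 + Q) = (1%:M - (P2 + Q)) *m (1%:M - P1).
  by rewrite mulmxBr mulmx1 mulmxBl mul1mx QP1 subrr subr0.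
by rewrite -mulmxA; apply: sqnorm_proj_le; exact: is_projC.
Qed.

End Projections.

(** * The projection on piecewise polynomials for a given partition *)

Section BlockProjection.
Context {R : realType} {n K : nat}.
Implicit Types (B : {set {set 'I_n}}) (S : {set 'I_n}) (Z : 'M[R]_(n, K.+1)).

(** Restriction of vectors to [S]; its transpose extends by zero outside [S]. *)
Let sel S : 'M[R]_(#|S|, n) := sub_rows 1%:M S.

Definition block_proj Z B : 'M[R]_n :=
  \sum_(S in B) (sel S)^T *m orth_proj (sub_rows Z S) *m sel S.

Lemma sub_rowsE {q} (A : 'M[R]_(n, q)) S : sub_rows A S = sel S *m A.
Proof. by rewrite /sel /sub_rows mul_rowsub_mx mul1mx. Qed.

Lemma sel_id S : sel S *m (sel S)^T = 1%:M.
Proof.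
apply/matrixP => i j; rewrite !mxE (bigD1 (enum_val i))//= big1; last first.
  by move=> k ki; rewrite !mxE eq_sym (negbTE ki) mul0r.
by rewrite !mxE eqxx mul1r addr0 (inj_eq enum_val_inj) eq_sym.
Qed.

Lemma sel_disjoint S S' : [disjoint S & S'] -> sel S *m (sel S')^T = 0.
Proof.
move=> SS'; apply/matrixP => i j; rewrite !mxE big1// => k _; rewrite !mxE.
case: eqP => [<-|]; last by rewrite mul0r.
case: eqP => [ij|]; last by rewrite mulr0.
have := enum_valP j; rewrite ij; have := enum_valP i.
by move=> /(disjointFr SS') ->.
Qed.

Lemma sel_sum B : finset.partition B [set: 'I_n] ->
  \sum_(S in B) (sel S)^T *m sel S = 1%:M.
Proof.
move=> BP; have /and3P[/eqP Bc Bt _] := BP.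
apply/matrixP => i j; rewrite summxE.
have iB : i \in finset.cover B by rewrite Bc inE.
rewrite (bigD1 (finset.pblock B i)) ?finset.pblock_mem//= big1 => [|S
  /andP[SB Si]].
  rewrite addr0 !mxE.
  have ip : i \in finset.pblock B i by rewrite finset.mem_pblock.
  rewrite (bigD1 (enum_rank_in ip i))//= big1 => [|k ki].
    by rewrite !mxE enum_rankK_in// eqxx mul1r addr0.
  rewrite !mxE; case: eqP => [ik|]; last by rewrite mul0r.
  by case/eqP: ki; apply: enum_val_inj; rewrite enum_rankK_in.
rewrite !mxE big1// => k _; rewrite !mxE; case: eqP => [ik|]; last
  by rewrite mul0r.
have := enum_valP k; rewrite ik => iS.
by rewrite (finset.def_pblock Bt SB iS) eqxx in Si.
Qed.

Lemma is_proj_block_proj Z B : finset.partition B [set: 'I_n] ->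
  is_proj (block_proj Z B).
Proof.
move=> /and3P[_ /finset.trivIsetP Bt _]; split.
  rewrite /block_proj linear_sum/=; apply: eq_bigr => S _.
  by rewrite !trmx_mul orth_proj_sym trmxK mulmxA.
rewrite /block_proj mulmx_suml; apply: eq_bigr => S SB.
rewrite mulmx_sumr (bigD1 S)//= big1 => [|S' /andP[S'B S'S]].
  rewrite addr0 !mulmxA -(mulmxA _ (sel S)) sel_id mulmx1.
  by rewrite -(mulmxA _ (orth_proj _) (orth_proj _)) orth_proj_idem.
rewrite !mulmxA -(mulmxA _ (sel S)) sel_disjoint ?mulmx0 ?mul0mx//.
by apply: Bt => //; rewrite eq_sym.
Qed.

(** Since [sel_sum] decomposes the identity along the blocks, the blockwise residuals assemble into
    one projection of the whole vector, to which [proj_join_excess] applies. *)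
Lemma residualE Z y B : finset.partition B [set: 'I_n] ->
  residual Z y B = sqnorm ((1%:M - block_proj Z B) *m y).
Proof.
move=> BP; rewrite sqnorm_proj; last exact/is_projC/is_proj_block_proj.
rewrite -(sel_sum BP) /block_proj -sumrB mulmx_sumr mulmx_suml summxE.
apply: eq_bigr => S SB.
rewrite sqnorm_proj; last exact/is_projC/is_proj_orth_proj.
rewrite sub_rowsE trmx_mul; congr (_ 0 0); rewrite !mulmxA; congr (_ *m _).
by rewrite mulmxBr mulmx1 mulmxBl -!mulmxA -mulmxBr.
Qed.

Lemma rank_block_proj_le Z B : (\rank (block_proj Z B) <= K.+1 * #|B|)%N.
Proof.
rewrite mulnC -sum_nat_const.
apply: (leq_trans _ (_ : \sum_(S in B) \rank ((sel S)^T *m orth_proj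
  (sub_rows Z S) *m sel S) <= _)%N).
  rewrite /block_proj; elim/big_rec2: _ => [|S m A _ IH]; first
    by rewrite mxrank0.
  by rewrite (leq_trans (mxrank_add _ _))// leq_add2l.
apply: leq_sum => S _.
rewrite (leq_trans (mxrankM_maxl _ _))// (leq_trans (mxrankM_maxr _ _))//.
rewrite -mxrank_tr (leq_trans (mxrankS (orth_proj_sub _)))// mxrank_tr.
exact: rank_leq_col.
Qed.

Lemma block_proj_id Z B (theta : 'cV[R]_n) :
  finset.partition B [set: 'I_n] -> design_basis Z ->
  piecewise_poly K B theta -> block_proj Z B *m theta = theta.
Proof.
move=> BP /andP[_ /andP[_ /submxP[D ZD]]] pw.
rewrite -[RHS]mul1mx -(sel_sum BP) /block_proj !mulmx_suml.
apply: eq_bigr => S SB; rewrite -!mulmxA; congr (_ *m _).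
have [p [pK pE]] := pw S SB.
have DZ : design R n K = Z *m D^T by rewrite -[LHS]trmxK ZD trmx_mul trmxK.
(* The coefficients of [p] express the block in the monomial columns of [design], and [D^T] rewrites
   these in the basis [Z]; so the block lies in the range of the local projection. *)
have -> : sel S *m theta = sub_rows Z S *m (D^T *m \col_k p`_k).
  rewrite sub_rowsE !mulmxA -(mulmxA _ Z) -DZ -!sub_rowsE.
  rewrite /sub_rows mul_rowsub_mx.
  apply/matrixP => i j; rewrite !mxE ord1 pE ?enum_valP//.
  rewrite (horner_coef_wide _ pK); apply: eq_bigr => k _.
  by rewrite !mxE mulrC.
by rewrite mulmxA orth_proj_id.
Qed.

End BlockProjection.

(** [theta] is in the range of the projection for [B0], which [Q] kills; hence [Q *m y] depends only
    on the noise [y - theta]. *)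
Lemma residual_excess {R : realType} {n K : nat} (Z : 'M[R]_(n, K.+1))
    (theta : 'cV[R]_n) (B B0 : {set {set 'I_n}}) :
  finset.partition B [set: 'I_n] -> finset.partition B0 [set: 'I_n] ->
  design_basis Z -> piecewise_poly K B0 theta ->
  exists Q : 'M[R]_n, [/\ is_proj Q, (\rank Q <= K.+1 * #|B|)%N &
    forall y, residual Z y B0 - residual Z y B <= sqnorm (Q *m (y - theta))].
Proof.
move=> BP B0P Zb pw.
have [Q [Qp Q0 Qr QE]] := proj_join_excess (is_proj_block_proj Z BP)
   (is_proj_block_proj Z B0P).
exists Q; split => // [|y]; first exact: (leq_trans Qr (rank_block_proj_le _
  _)).
rewrite !residualE// mulmxBr -[X in _ *m y - _ *m X](block_proj_id B0P Zb pw)//.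
by rewrite mulmxA Q0 mul0mx subr0.
Qed.

Local Open Scope classical_set_scope.
Local Open Scope ring_scope.

(** * Gaussian vectors *)

Section Integration.
Local Open Scope ereal_scope.
Context {d d'} {T : measurableType d} {U : measurableType d'} {R : realType}.
Import HBNNSimple.

(** Simple functions and monotone convergence extend the identity from indicators. The instances
    below are a density ([X] the identity), the law of a variable ([W] equal to 1), and one factor
    of a product of independent variables ([W] the product of the others). *)
Lemma ge0_integral_weighted (mu : {measure set T -> \bar R})
    (nu : {measure set U -> \bar R}) (X : T -> U) (W : T -> R) (f : U -> R) :
  measurable_fun setT X -> measurable_fun setT W -> (forall t, (0 <= W t)%R) ->
  (forall A, measurable A -> \int[mu]_t (W t * \1_A (X t))%:E = nu A) ->
  measurable_fun setT f -> (forall u, (0 <= f u)%R) ->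
  \int[mu]_t (W t * f (X t))%:E = \int[nu]_u (f u)%:E.
Proof.
move=> mX mW W0 WE mf f0.
have mF : measurable_fun setT (fun u => (f u)%:E) by exact/measurable_EFinP.
pose g := nnsfun_approx measurableT mF.
have g_cvg u : (g n u)%:E @[n --> \oo] --> (f u)%:E.
  by apply: (cvg_nnsfun_approx measurableT mF) => // x _; rewrite lee_fin.
have mgX n : measurable_fun setT (fun t => g n (X t))
  by exact: measurableT_comp.
(* Simple functions are finite combinations of indicators of preimages, so linearity suffices. *)
have gE n : \int[mu]_t (W t * g n (X t))%:E = \int[nu]_u (g n u)%:E.
  under eq_integral => t _.
    rewrite (fimfunE (g n)) EFinM -fsumEFin// ge0_mule_fsumr; last first.
      by move=> r; rewrite EFinM; exact: nnfun_muleindic_ge0.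
    over.
  rewrite ge0_integral_fsum//; last 2 first.
  - move=> r; apply: emeasurable_funM; first exact/measurable_EFinP.
    apply/measurable_EFinP/measurable_funM => //.
    exact: (measurableT_comp (measurable_indic _)).
  - move=> r t _; apply: mule_ge0; first by rewrite lee_fin.
    by rewrite EFinM; exact: nnfun_muleindic_ge0.
  under [RHS]eq_integral => u _ do rewrite (fimfunE (g n)) -fsumEFin//.
  rewrite ge0_integral_fsum//; last 2 first.
  - by move=> r; apply/measurable_EFinP/measurable_funM.
  - by move=> r t _; rewrite EFinM; exact: nnfun_muleindic_ge0.
  apply: eq_fsbigr => r; rewrite inE => -[u _ <-].
  under eq_integral => t _ do
    rewrite -EFinM mulrCA EFinM.
  rewrite ge0_integralZl//; last 3 first.
  - apply/measurable_EFinP/measurable_funM => //.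
    exact: (measurableT_comp (measurable_indic _)).
  - by move=> t _; rewrite lee_fin mulr_ge0.
  - by rewrite lee_fin.
  under [RHS]eq_integral => t _ do rewrite EFinM.
  rewrite ge0_integralZl//; last 2 first.
  - by apply/measurable_EFinP; exact: measurable_indic.
  - by rewrite lee_fin.
  by congr (_ * _); rewrite WE// integral_indic// setIT.
(* Both sides are limits of the same sequence of integrals, by monotone convergence. *)
have : \int[mu]_t (W t * g n (X t))%:E @[n --> \oo] --> \int[mu]_t (W t * f
  (X t))%:E.
  have -> : (fun t => (W t * f (X t))%:E) =
      (fun t => limn ((fun n t => (W t * g n (X t))%:E) ^~ t)).
    apply/funext => t; apply/esym/cvg_lim => //.
    rewrite EFinM; under eq_fun do rewrite EFinM.
    by apply: cvgeZl => //; exact: g_cvg.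
  apply: cvg_monotone_convergence => //.
  - by move=> n; apply/measurable_EFinP/measurable_funM.
  - by move=> n t _; rewrite lee_fin mulr_ge0.
  - move=> t _ a b ab; rewrite lee_fin ler_wpM2l//.
    exact/lefP/nd_nnsfun_approx.
under eq_fun do rewrite gE.
move=> mu_cvg; apply: (cvg_unique _ mu_cvg) => //.
have -> : (fun u => (f u)%:E) =
    (fun t => limn ((fun n t => (g n t)%:E) ^~ t)).
  by apply/funext => t; apply/esym/cvg_lim => //; exact: g_cvg.
apply: (@cvg_monotone_convergence _ _ _ nu _ measurableT (fun n t => (g n
  t)%:E)) => //.
- by move=> n; exact/measurable_EFinP.
- by move=> n t _; rewrite lee_fin.
- by move=> t _ a b ab; rewrite lee_fin; exact/lefP/nd_nnsfun_approx.
Qed.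

End Integration.

(** * Exponential integrals of the one-dimensional normal law *)

Section Normal.
Context {R : realType}.
Local Notation mu := (@lebesgue_measure R).

Lemma ge0_integral_normal_prob (m s : R) (f : R -> R) :
  measurable_fun setT f -> (forall x, 0 <= f x) ->
  (\int[normal_prob m s]_x (f x)%:E =
   \int[mu]_x (normal_pdf m s x * f x)%:E)%E.
Proof.
move=> mf f0; apply/esym.
apply: (@ge0_integral_weighted _ _ _ _ _ mu (normal_prob m s) idfun) => //.
- exact: measurable_id.
- exact: measurable_normal_pdf.
- by move=> x; exact: normal_pdf_ge0.
- move=> A mA; rewrite /normal_prob/= [RHS]integral_mkcond.
  apply: eq_integral => x _; rewrite /= patchE indicE.
  by case: ifPn => _; rewrite (mulr1, mulr0).
Qed.

(** Completing the square turns the tilted density into a constant times the normal density with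
    mean shifted by [s ^+ 2 * c]. *)
Lemma integral_normal_expR (m s c : R) : 0 < s ->
  (\int[normal_prob m s]_x (expR (c * (x - m)))%:E =
   (expR (s ^+ 2 * c ^+ 2 / 2))%:E)%E.
Proof.
move=> s0; have s1 : s != 0 by rewrite gt_eqF.
rewrite ge0_integral_normal_prob; [|by apply: measurableT_comp => //;
  apply: measurable_funM => //;
     exact: measurable_funB|by move=> x; exact: expR_ge0].
transitivity (\int[mu]_x ((expR (s ^+ 2 * c ^+ 2 / 2))%:E *
   (normal_pdf (m + s ^+ 2 * c) s x)%:E))%E.
  apply: eq_integral => x _; rewrite -EFinM !normal_pdfE//; congr EFin.
  rewrite /normal_fun mulrCA -[LHS]mulrA; congr (_ * _).
  rewrite -!expRD; congr expR; by field; rewrite s1.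
rewrite ge0_integralZl//.
- by rewrite integral_normal_pdf mule1.
- by apply/measurable_EFinP; exact: measurable_normal_pdf.
- by move=> x _; rewrite lee_fin normal_pdf_ge0.
Qed.

(** The tilted standard density is [s] times the centred normal density of variance [(1 - a)^-1]. *)
Lemma integral_normal_expR_sqr (a : R) : a < 1 ->
  (\int[normal_prob 0 1]_x (expR (a / 2 * x ^+ 2))%:E =
   ((Num.sqrt (1 - a))^-1)%:E)%E.
Proof.
move=> a1; have b0 : 0 < 1 - a by rewrite subr_gt0.
pose s := (Num.sqrt (1 - a))^-1.
have s0 : 0 < s by rewrite invr_gt0 sqrtr_gt0.
have s2 : s ^+ 2 = (1 - a)^-1 by rewrite exprVn sqr_sqrtr ?ltW.
rewrite ge0_integral_normal_prob; [|by apply: measurableT_comp => //;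
  apply: measurable_funM => //;
     exact: measurable_funX|by move=> x; exact: expR_ge0].
transitivity (\int[mu]_x (s%:E * (normal_pdf 0 s x)%:E))%E.
  apply: eq_integral => x _; rewrite -EFinM !normal_pdfE ?oner_eq0 ?gt_eqF//.
  congr EFin; rewrite /normal_fun /normal_peak.
  have -> : Num.sqrt (s ^+ 2 * pi *+ 2) = s * Num.sqrt (1 ^+ 2 * pi *+ 2).
    rewrite -mulrnAr sqrtrM ?sqr_ge0// sqrtr_sqr gtr0_norm// expr1n.
    by rewrite mul1r.
  rewrite invfM !mulrA divff ?gt_eqF// mul1r -[LHS]mulrA; congr (_ * _).
  rewrite -expRD; congr expR; rewrite s2; field.
  by rewrite gt_eqF.
rewrite ge0_integralZl//.
- by rewrite integral_normal_pdf mule1.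
- by apply/measurable_EFinP; exact: measurable_normal_pdf.
- by move=> x _; rewrite lee_fin normal_pdf_ge0.
- by rewrite lee_fin ltW.
Qed.

End Normal.

(** * Expectation of a product of functions of independent variables *)

Section Independence.
Context {d} {T : measurableType d} {R : realType} {P : probability T R}.
Context {I : finType} (Y : I -> {RV P >-> R}).

Lemma integral_indic_preimage (X : {RV P >-> R}) (A : set R) : measurable A ->
  (\int[P]_w (\1_A (X w))%:E = P (X @^-1` A))%E.
Proof.
move=> mA; transitivity (\int[P]_w (\1_(X @^-1` A) w)%:E)%E.
  exact: eq_integral.
by rewrite integral_indic ?setIT//; exact: measurable_funPTI.
Qed.

(* The general factors, indexed by [J], are traded one by one for indicators:
   as a function of one factor, the left-hand side is an integral. *)
Let integral_prod_aux (J : {set I}) (g : I -> R -> R) (m : I -> R) :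
  mutually_independent Y ->
  (forall i, measurable_fun setT (g i)) -> (forall i x, 0 <= g i x) ->
  (forall i, (\int[P]_w (g i (Y i w))%:E = (m i)%:E)%E) ->
  (forall i, i \notin J -> exists A, measurable A /\ g i = \1_A) ->
  (\int[P]_w (\prod_i g i (Y i w))%:E = (\prod_i m i)%:E)%E.
Proof.
move=> indep; elim: {J}_.+1 {-2}J (ltnSn #|J|) g m => // k IH J Jk g m mg g0
  gm gJ.
have [J0|/set0Pn[i iJ]] := eqVneq J finset.set0.
  (* With no general factor left, the product is the indicator of an intersection, and independence
     applies directly. *)
  have /choice[A AE] : forall i, exists A, measurable A /\ g i = \1_A.
    by move=> i; apply: gJ; rewrite J0 inE.
  have mA i : measurable (A i) by have [] := AE i.
  have mYA i : measurable (Y i @^-1` A i) by exact: measurable_funPTI.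
  have mYI : measurable (\bigcap_(i in [set` [set: I]%SET]) (Y i @^-1` A i)).
    by apply: fin_bigcap_measurable => //; exact: finite_finset.
  transitivity (\int[P]_w (\1_(\bigcap_(i in [set` [set: I]%SET]) (Y i @^-1`
    A i)) w)%:E)%E.
    apply: eq_integral => w _; congr EFin; rewrite indicE.
    have [wA|wA] := boolP (w \in _).
      rewrite big1// => i _; have [_ ->] := AE i; rewrite indicE mem_set//.
      by move: wA; rewrite inE; apply => /=; rewrite inE.
    apply/eqP; move: wA; apply: contraNT => /prodf_neq0 wA.
    rewrite inE => i _ /=; have := wA i isT; have [_ ->] := AE i.
    by rewrite indicE pnatr_eq0 eqb0 negbK inE.
  rewrite integral_indic// setIT; apply: (etrans (indep _ _ mA));
    rewrite -prodEFin.
  apply: eq_big => i; first by rewrite inE.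
  move=> _; rewrite -gm; have [_ ->] := AE i.
  exact/esym/integral_indic_preimage.
have mgY j : measurable_fun setT (fun w => g j (Y j w))
  by exact: measurableT_comp.
have m0 j : 0 <= m j by rewrite -lee_fin -gm integral_ge0// => w _;
  rewrite lee_fin.
pose W w := \prod_(j | j != i) g j (Y j w).
have M0 : 0 <= \prod_(j | j != i) m j by exact: prodr_ge0.
(* In terms of the factor [i] alone, the left-hand side is the integral against the law of [Y i]
   scaled by the means of the other factors. *)
pose M : {nonneg R} := NngNum M0.
have WE : (\int[P]_w (W w * g i (Y i w))%:E =
    \int[mscale M (distribution P (Y i))]_x (g i x)%:E)%E.
  apply: ge0_integral_weighted => //.
  - rewrite /W; under eq_fun do rewrite -big_filter.
    by apply: measurable_prod => j _; exact: mgY.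
  - by move=> w; exact: prodr_ge0.
  move=> A mA.
  (* Testing on [A] makes the factor [i] an indicator, so only [J :\ i] still carries general
     factors and the induction hypothesis applies. *)
  pose g' j := if j == i then \1_A else g j.
  pose m' j := if j == i then fine (P (Y i @^-1` A)) else m j.
  have mYA : measurable (Y i @^-1` A) by exact: measurable_funPTI.
  have Jik : (#|J :\ i| < k)%N by move: Jk; rewrite (cardsD1 i) iJ.
  transitivity (\int[P]_w (\prod_j g' j (Y j w))%:E)%E.
    apply: eq_integral => w _; rewrite (bigD1 i)//= {1}/g' eqxx mulrC.
    by congr (_ * _)%:E; apply: eq_bigr => j /negbTE ji; rewrite /g' ji.
  rewrite (IH _ Jik g' m').
  - rewrite (bigD1 i)//= {1}/m' eqxx mulrC EFinM fineK ?fin_num_measure//.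
    by congr (_%:E * _)%E; apply: eq_bigr => j /negbTE ji; rewrite /m' ji.
  - by move=> j; rewrite /g'; case: ifP.
  - by move=> j x; rewrite /g'; case: ifP.
  - move=> j; rewrite /g' /m'; case: ifP => // /eqP ->.
    by rewrite fineK ?fin_num_measure// integral_indic_preimage.
  - move=> j; rewrite !inE negb_and negbK /g'; case: eqP => /= [_ _|_ /gJ//].
    by exists A.
under eq_integral => w _ do rewrite (bigD1 i)//= mulrC.
rewrite WE ge0_integral_mscale//; last 2 first.
- exact/measurable_EFinP.
- by move=> x _; rewrite lee_fin.
rewrite ge0_integral_distribution; last 2 first.
- exact/measurable_EFinP.
- by move=> x; rewrite lee_fin.
by rewrite gm (bigD1 i)//= mulrC EFinM.
Qed.

Lemma integral_prod_independent (g : I -> R -> R) (m : I -> R) :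
  mutually_independent Y ->
  (forall i, measurable_fun setT (g i)) -> (forall i x, 0 <= g i x) ->
  (forall i, (\int[P]_w (g i (Y i w))%:E = (m i)%:E)%E) ->
  (\int[P]_w (\prod_i g i (Y i w))%:E = (\prod_i m i)%:E)%E.
Proof.
by move=> Yi mg g0 gm; apply: (@integral_prod_aux [set: I]%SET) => // i;
  rewrite inE.
Qed.

End Independence.

Section MeasurableVectors.
Context {d} {T : measurableType d} {R : realType} {m n : nat}.

Lemma measurable_lin (y : T -> 'cV[R]_n) (A : 'M[R]_(m, n)) i :
  (forall j, measurable_fun setT (fun w => y w j 0)) ->
  measurable_fun setT (fun w => (A *m y w) i 0).
Proof.
move=> my; under eq_fun do rewrite mxE.
by apply: measurable_sum => j; exact: measurable_funM.
Qed.

Lemma measurable_sqnorm (y : T -> 'cV[R]_n) :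
  (forall j, measurable_fun setT (fun w => y w j 0)) ->
  measurable_fun setT (fun w => sqnorm (y w)).
Proof.
by move=> my; apply: measurable_sum => j; exact: measurable_funX.
Qed.

End MeasurableVectors.

(** * Exponential moments of linear and quadratic forms in Gaussian noise *)

Section Gaussian.
Context {d} {T : measurableType d} {R : realType} {P : probability T R}.
Context {n : nat} (theta : 'cV[R]_n) (sigma : R) (Y : 'I_n -> {RV P >-> R}).
Let eps w : 'cV[R]_n := \col_i Y i w - theta.

Let meps j : measurable_fun setT (fun w => eps w j 0).
Proof.
under eq_fun do rewrite !mxE; exact: measurable_funB.
Qed.

Hypothesis sigma_gt0 : 0 < sigma.
Hypothesis Yg : isotropic_gaussian theta sigma Y.

(** The exponential of a linear form is a product over the independent coordinates, each with a
    known one-dimensional integral. *)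
Lemma gaussian_mgf (c : 'cV[R]_n) :
  (\int[P]_w (expR ((c^T *m eps w) 0 0))%:E =
   (expR (sigma ^+ 2 / 2 * sqnorm c))%:E)%E.
Proof.
have [Yi YN] := Yg.
pose g i x := expR (c i 0 * (x - theta i 0)).
have mg i : measurable_fun setT (g i).
  by apply: measurableT_comp => //; apply: measurable_funM => //;
    exact: measurable_funB.
transitivity (\int[P]_w (\prod_i g i (Y i w))%:E)%E.
  apply: eq_integral => w _; congr EFin; rewrite -expR_sum; congr expR.
  by rewrite mxE; apply: eq_bigr => i _; rewrite !mxE.
rewrite (@integral_prod_independent _ _ _ _ _ _ _
  (fun i => expR (sigma ^+ 2 * c i 0 ^+ 2 / 2))) //.
- rewrite -expR_sum; congr (expR _)%:E.
  by rewrite /sqnorm mulr_sumr; apply: eq_bigr => i _; rewrite mulrAC.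
- by move=> i x; exact: expR_ge0.
- move=> i; rewrite -(integral_normal_expR (theta i 0) (c i 0) sigma_gt0).
  transitivity (\int[P]_w (1 * g i (Y i w))%:E)%E.
    by apply: eq_integral => w _; rewrite mul1r.
  apply: (@ge0_integral_weighted _ _ _ _ _ P (normal_prob (theta i 0) sigma)
    (Y i) (cst 1) (g i)) => //.
  + by move=> mT A mA; exact: (measurable_funPT (Y i) mT A mA).
  + move=> A mA; under eq_integral do rewrite mul1r.
    by rewrite integral_indic_preimage//; exact: YN.
  + exact: mg.
  + by move=> x; exact: expR_ge0.
Qed.

(* Each unit direction [u] of the range of [Q] is removed by writing
   [exp (a x^2 / 2)] as the mean of [exp (sqrt a * g * x)] over a standard
   Gaussian [g]; the extra linear term [c] makes the induction go through. *)
Lemma gaussian_projection_mgf_lin (alpha : R) (r : nat) (Q : 'M[R]_n)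
    (c : 'cV[R]_n) :
  0 <= alpha < 1 -> is_proj Q -> (\rank Q <= r)%N -> Q *m c = 0 ->
  (\int[P]_w (expR ((c^T *m eps w) 0 0
      + alpha / (2 * sigma ^+ 2) * sqnorm (Q *m eps w)))%:E <=
   ((Num.sqrt (1 - alpha))^-1 ^+ r * expR (sigma ^+ 2 / 2 * sqnorm c))%:E)%E.
Proof.
move=> /andP[a0 a1].
have b0 : 0 < 1 - alpha by rewrite subr_gt0.
have s1 : 1 <= (Num.sqrt (1 - alpha))^-1.
  rewrite invf_ge1 ?sqrtr_gt0// -[leRHS]sqrtr1 ler_sqrt// lerBlDr lerDl//.
elim: r Q c => [|r IH] Q c Qp Qr Qc.
  move: Qr; rewrite leqn0 mxrank_eq0 => /eqP ->.
  under eq_integral => w _.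
    rewrite mul0mx /sqnorm big1 => [|i _]; last by rewrite mxE expr0n.
    rewrite mulr0 addr0; over.
  by rewrite gaussian_mgf expr0 mul1r.
(* The rank is only bounded above, so [Q] may vanish and offer no direction to remove; the bound for
   [r] then suffices because an extra factor is at least 1. *)
have [Q0|Q0] := eqVneq Q 0.
  apply: (le_trans (IH Q c Qp _ Qc)); first by rewrite Q0 mxrank0.
  by rewrite lee_fin ler_wpM2r ?expR_ge0// exprS ler_peMl// exprn_ge0 ?invr_ge0.
have [u [u1 Qu Q'p Q'r]] := is_proj_peel Qp Q0.
set Q' := Q - u *m u^T in Q'p Q'r.
have {}Q'r : (\rank Q' <= r)%N by rewrite -ltnS (leq_trans Q'r).
have [QT QQ] := Qp.
(* With this scale, the mean of exp (k g x) over a standard Gaussian g is exp (alpha x^2 / (2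
   sigma^2)). *)
pose k := Num.sqrt alpha / sigma.
have k2 : k ^+ 2 = alpha / sigma ^+ 2 by rewrite /k expr_div_n sqr_sqrtr.
have uQ : u^T *m Q = u^T by rewrite -[in LHS]QT -trmx_mul Qu.
have uc : u^T *m c = 0 by rewrite -uQ -mulmxA Qc mulmx0.
have uu : u^T *m u = 1%:M.
  by apply/matrixP => a b; rewrite !ord1 -sqnormE u1 mxE.
have cu : c^T *m u = 0 by apply: trmx_inj; rewrite trmx_mul trmxK uc trmx0.
pose x w := (u^T *m eps w) 0 0.
have QE w : sqnorm (Q *m eps w) = sqnorm (Q' *m eps w) + x w ^+ 2.
  rewrite !sqnorm_proj// /x; move: (eps w) => e.
  have -> : e^T *m Q *m e = e^T *m Q' *m e + (u^T *m e)^T *m (u^T *m e).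
    by rewrite /Q' mulmxBr mulmxBl trmx_mul trmxK !mulmxA subrK.
  by rewrite mxE [X in _ + X]mxE big_ord1 [X in X * _]mxE.
pose f (z : T * R) := expR ((c^T *m eps z.1) 0 0 + k * z.2 * x z.1
    + alpha / (2 * sigma ^+ 2) * sqnorm (Q' *m eps z.1)).
have mf : measurable_fun setT (fun z => (f z)%:E).
  apply/measurable_EFinP/measurableT_comp => //.
  apply: measurable_funD; first apply: measurable_funD.
  - by apply: (measurable_lin (y := fun z => eps z.1)) => j;
      exact: (measurableT_comp (meps j)).
  - apply: measurable_funM; first exact: measurable_funM.
    by apply: (measurable_lin (y := fun z => eps z.1)) => j;
      exact: (measurableT_comp (meps j)).
  - apply: measurable_funM => //; apply: measurable_sqnorm => i.
    by apply: (measurable_lin (y := fun z => eps z.1)) => j;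
      exact: (measurableT_comp (meps j)).
have -> : (\int[P]_w (expR ((c^T *m eps w) 0 0
      + alpha / (2 * sigma ^+ 2) * sqnorm (Q *m eps w)))%:E =
   \int[P]_w \int[normal_prob 0 1]_g (f (w, g))%:E)%E.
  apply: eq_integral => w _.
  transitivity (\int[normal_prob 0 1]_g ((expR ((c^T *m eps w) 0 0
      + alpha / (2 * sigma ^+ 2) * sqnorm (Q' *m eps w)))%:E
      * (expR (k * x w * (g - 0)))%:E))%E.
    rewrite ge0_integralZl//; last first.
    - apply/measurable_EFinP; apply: measurableT_comp => //.
      by apply: measurable_funM => //; exact: measurable_funB.
    rewrite integral_normal_expR// -EFinM -expRD QE; congr (expR _)%:E.
    rewrite exprMn k2; by field; rewrite gt_eqF.
  apply: eq_integral => g _; rewrite -EFinM -expRD; congr (expR _)%:E.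
  by rewrite /=; ring.
(* Exchanging the integrals lets the induction hypothesis act on the noise at each fixed [g]. *)
rewrite (@fubini_tonelli _ _ _ _ _ P (normal_prob 0 1) (fun z => (f
  z)%:E))//; last first.
  by move=> z; rewrite lee_fin expR_ge0.
apply: (@le_trans _ _ (\int[normal_prob 0 1]_g
   (((Num.sqrt (1 - alpha))^-1 ^+ r * expR (sigma ^+ 2 / 2 * sqnorm c))%:E *
    (expR (alpha / 2 * g ^+ 2))%:E))%E).
  apply: ge0_le_integral => //.
  - by move=> g _; apply: integral_ge0 => w _; rewrite lee_fin expR_ge0.
  - apply: (@measurable_fun_fubini_tonelli_G _ _ _ _ _ P (fun z => (f z)%:E))
      => //.
    by move=> z; rewrite lee_fin expR_ge0.
  - apply: measurable_funeM; apply/measurable_EFinP;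
      apply: measurableT_comp => //.
    by apply: measurable_funM => //; exact: measurable_funX.
  (* The linear term in [u] is absorbed into [c]; since [Q'] kills [u], it kills [c'] as the
     induction hypothesis demands. *)
  move=> g _; pose c' := c + (k * g) *: u.
  have c'T : c'^T = c^T + (k * g) *: u^T by apply/matrixP => i j; rewrite !mxE.
  have Q'c : Q' *m c' = 0.
    rewrite /c' mulmxDr -scalemxAr /Q' !mulmxBl Qc Qu -!mulmxA uc uu.
    by rewrite mulmx0 mulmx1 !subrr scaler0 addr0.
  apply: (le_trans _ (le_trans (IH Q' c' Q'p Q'r Q'c) _)).
    rewrite le_eqVlt; apply/orP; left; apply/eqP; apply: eq_integral => w _.
    congr (expR (_ + _))%:E.
    by rewrite c'T mulmxDl -scalemxAl [in RHS]mxE [X in _ = _ + X]mxE.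
  rewrite -EFinM lee_fin -[leRHS]mulrA -expRD le_eqVlt; apply/orP; left;
    apply/eqP.
  congr (_ * expR _).
  (* [c] is orthogonal to [u]. The extra square contributes [alpha / 2 * g ^+ 2] to the exponent,
     and its integral over [g] supplies the missing factor [(Num.sqrt (1 - alpha))^-1]. *)
  have -> : sqnorm c' = sqnorm c + (k * g) ^+ 2.
    rewrite sqnormE c'T /c' mulmxDl !mulmxDr -!scalemxAl -!scalemxAr cu uc uu.
    rewrite !scaler0 addr0 add0r scalerA mxE -sqnormE; congr (_ + _).
    by rewrite !mxE mulr1n mulr1 expr2.
  rewrite exprMn k2; by field; rewrite gt_eqF.
rewrite ge0_integralZl//; last first.
- apply/measurable_EFinP; apply: measurableT_comp => //.
  by apply: measurable_funM => //; exact: measurable_funX.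
by rewrite integral_normal_expR_sqr// -EFinM lee_fin (exprSr _ r)
  [leRHS]mulrAC lexx.
Qed.

Lemma gaussian_projection_mgf (alpha : R) (r : nat) (Q : 'M[R]_n) :
  0 <= alpha < 1 -> is_proj Q -> (\rank Q <= r)%N ->
  (\int[P]_w (expR (alpha / (2 * sigma ^+ 2) * sqnorm (Q *m eps w)))%:E <=
   ((Num.sqrt (1 - alpha))^-1 ^+ r)%:E)%E.
Proof.
move=> a01 Qp Qr.
have := gaussian_projection_mgf_lin a01 Qp Qr (mulmx0 _ _).
rewrite {2}/sqnorm big1 => [|i _]; last by rewrite mxE expr0n.
rewrite mulr0 expR0 mulr1.
by under eq_integral do rewrite trmx0 mul0mx mxE add0r.
Qed.

End Gaussian.

(** * Simple partitions *)

Section Counting.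
Context {n : nat}.
Implicit Types (B : {set {set 'I_n}}) (S : {set 'I_n}).

Definition block_starts B : {set 'I_n} :=
  [set i | [forall j in finset.pblock B i, (i <= j)%N]]%SET.

Lemma in_pblock B i : simple_partition B -> i \in finset.pblock B i.
Proof.
by move=> /andP[/and3P[/eqP Bc _ _] _]; rewrite finset.mem_pblock Bc inE.
Qed.

Lemma pblock_in B i : simple_partition B -> finset.pblock B i \in B.
Proof.
by move=> /andP[/and3P[/eqP Bc _ _] _]; rewrite finset.pblock_mem// Bc inE.
Qed.

Lemma pblockP B S i : simple_partition B -> S \in B -> i \in S ->
  finset.pblock B i = S.
Proof. by move=> /andP[/and3P[_ Bt _] _]; exact: finset.def_pblock. Qed.

Lemma block_startP B S : simple_partition B -> S \in B ->
  exists2 i, i \in block_starts B & i \in S.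
Proof.
move=> Bs SB; have /andP[/and3P[_ _ B0] _] := Bs.
have /finset.set0Pn[i0 i0S] : S != finset.set0.
  by apply: contraNneq B0 => <-.
case: (arg_minnP (fun i : 'I_n => i : nat) i0S) => i iS imin.
exists i => //; rewrite inE (pblockP Bs SB iS).
by apply/forall_inP => j jS; exact: imin.
Qed.

Lemma card_block_starts B : simple_partition B -> #|block_starts B| = #|B|.
Proof.
move=> Bs; have BE : (finset.pblock B @: block_starts B = B)%SET.
  apply/setP => S; apply/imsetP/idP => [[i _ ->]|SB]; first exact: pblock_in.
  have [i i0 iS] := block_startP Bs SB.
  by exists i => //; rewrite (pblockP Bs SB iS).
rewrite -[in RHS]BE card_in_imset// => i j;
  rewrite !inE => /forall_inP imin /forall_inP jmin ij.
apply: val_inj; apply/eqP; rewrite eqn_leq imin ?jmin//.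
  by rewrite -ij in_pblock.
by rewrite ij in_pblock.
Qed.

(** As blocks are consecutive, a start [m] with [i < m <= j] would lie in the block of [i] if [j]
    did, against its minimality. If there is none, the block of [j] starts at or before [i], hence
    contains [i]. *)
Lemma mem_pblock_starts B (i j : 'I_n) : simple_partition B -> (i <= j)%N ->
  (j \in finset.pblock B i) = [forall m in block_starts B, ~~ (i < m <= j)%N].
Proof.
move=> Bs ij; have /andP[_ /forall_inP Bcons] := Bs.
have iB := pblock_in i Bs; have jB := pblock_in j Bs.
have := Bcons _ iB => /forall_inP ci; have := Bcons _ jB => /forall_inP cj.
apply/idP/forall_inP => [jS m|no_start].
  rewrite inE => /forall_inP mmin; apply/negP => /andP[im mj].
  have mS : m \in finset.pblock B i.
    have /forall_inP/(_ _ jS)/forallP/(_ m)/implyP := ci i (in_pblock i Bs).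
    by apply; rewrite (ltnW im).
  have := mmin i; rewrite (pblockP Bs iB mS) in_pblock// => /(_ isT).
  by rewrite leqNgt im.
have [m m0 mS] := block_startP Bs jB.
have mj : (m <= j)%N.
  by move: m0; rewrite inE (pblockP Bs jB mS) => /forall_inP; apply;
    exact: in_pblock.
have := no_start _ m0; rewrite mj andbT -leqNgt => mi.
have iS : i \in finset.pblock B j.
  have /forall_inP/(_ _ (in_pblock j Bs))/forallP/(_ i)/implyP := cj m mS.
  by apply; rewrite mi.
by rewrite (pblockP Bs jB iS) in_pblock.
Qed.

(** [mem_pblock_starts] recovers from the starts whether two indices share a block; the symmetry of
    this relation covers both orders of the indices. *)
Lemma block_starts_inj B B' : simple_partition B -> simple_partition B' ->
  block_starts B = block_starts B' -> B = B'.
Proof.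
move=> Bs Bs' st.
have pb i : finset.pblock B i = finset.pblock B' i.
  have ge (i' j : 'I_n) : (i' <= j)%N ->
    (j \in finset.pblock B i') = (j \in finset.pblock B' i').
    by move=> ij; rewrite !mem_pblock_starts// st.
  have sym (D : {set {set 'I_n}}) k l : simple_partition D ->
      (k \in finset.pblock D l) = (l \in finset.pblock D k).
    move=> Ds; apply/idP/idP => [kl|lk].
      by rewrite (pblockP Ds (pblock_in l Ds) kl) in_pblock.
    by rewrite (pblockP Ds (pblock_in k Ds) lk) in_pblock.
  apply/setP => j; have [ij|/ltnW ji] := leqP i j; first exact: ge.
  by rewrite !(sym _ j i)//; exact: ge.
apply/eqP; rewrite finset.eqEsubset; apply/andP; split;
  apply/fintype.subsetP => S SB.
  by have [i _ iS] := block_startP Bs SB;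
    rewrite -(pblockP Bs SB iS) pb pblock_in.
by have [i _ iS] := block_startP Bs' SB;
  rewrite -(pblockP Bs' SB iS) -pb pblock_in.
Qed.

(** The smallest index always starts a block, so a partition is determined by its [b.-1] other
    starts among [n.-1] indices. *)
Lemma card_simple_partition_le b : (0 < n)%N ->
  (#|[set B : {set {set 'I_n}} | simple_partition B & #|B| == b]%SET|
   <= 'C(n.-1, b.-1))%N.
Proof.
move=> n0; pose z : 'I_n := Ordinal n0.
have zB B : simple_partition B -> z \in block_starts B.
  by move=> Bs; rewrite inE; apply/forall_inP.
have <- : #|[set~ z]%SET| = n.-1 by rewrite cardsC1 card_ord.
rewrite -cards_draws.
rewrite -(card_in_imset (f := fun B => block_starts B :\ z)%SET); last first.
  move=> B B'; rewrite !inE => /andP[Bs _] /andP[Bs' _] eqB.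
  apply: block_starts_inj => //.
  by rewrite -(finset.setD1K (zB _ Bs)) eqB finset.setD1K// zB.
apply/subset_leq_card/fintype.subsetP => _ /imsetP[B + ->].
rewrite !inE => /andP[Bs /eqP <-]; apply/andP; split.
  by apply/fintype.subsetP => i; rewrite !inE => /andP[].
by rewrite -card_block_starts// (cardsD1 z (block_starts B)) zB.
Qed.

Lemma card_blocks_le B : simple_partition B -> (#|B| <= n)%N.
Proof.
by move=> Bs; rewrite -card_block_starts// (leq_trans (max_card _))// card_ord.
Qed.

Lemma card_blocks_gt0 B : (0 < n)%N -> simple_partition B -> (0 < #|B|)%N.
Proof.
move=> n0 Bs; apply/card_gt0P; exists (finset.pblock B (Ordinal n0)).
exact: pblock_in.
Qed.

Lemma sum_simple_partition_le {R : realFieldType} (E : pred nat) (F : nat ->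
  R) :
  (0 < n)%N -> (forall b, 0 <= F b) ->
  \sum_(B : {set {set 'I_n}} | simple_partition B && E #|B|)
     'C(n.-1, #|B|.-1)%:R^-1 * F #|B| <= \sum_(b < n.+1 | E b) F b.
Proof.
move=> n0 F0.
(* At most [n] blocks occur, so [inord] does not fall back on its default value. *)
have cardE B : simple_partition B -> (inord #|B| : 'I_n.+1) = #|B| :> nat.
  by move=> Bs; rewrite inordK// ltnS card_blocks_le.
rewrite (partition_big (fun B => inord #|B| : 'I_n.+1) (fun b => E b))/=;
  last first.
  by move=> B /andP[Bs EB]; rewrite cardE.
apply: ler_sum => b Eb.
pose D := [set B : {set {set 'I_n}} | simple_partition B & #|B| == b]%SET.
rewrite (eq_big (mem D) (fun=> 'C(n.-1, b.-1)%:R^-1 * F b)); first last.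
- move=> B /andP[/andP[Bs _] /eqP bE].
  by rewrite -(cardE _ Bs) bE.
- move=> B; rewrite /= !inE; case Bs: (simple_partition B) => //=.
  by rewrite -val_eqE/= cardE//; case: eqP => [->|]; rewrite ?Eb ?andbF.
rewrite sumr_const -mulrnAl -[leRHS]mul1r ler_wpM2r// -mulr_natr.
(* A zero binomial would have inverse 0 by convention, which makes the bound trivial. *)
have [->|C0] := posnP 'C(n.-1, b.-1); first by rewrite invr0 mul0r.
by rewrite mulrC ler_pdivrMr ?ltr0n// mul1r ler_nat card_simple_partition_le.
Qed.

End Counting.

(** * The posterior *)

Section Posterior.
Context {R : realType} {n K : nat} {lambda v alpha sigma : R}.
Context (Z : 'M[R]_(n, K.+1)).
Implicit Types (y : 'cV[R]_n) (B : {set {set 'I_n}}).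
Hypotheses (n_gt0 : (0 < n)%N) (sigma_gt0 : 0 < sigma).
Hypotheses (v_gt0 : 0 < v) (alpha_gt0 : 0 < alpha).
Local Notation weight := (posterior_weight lambda v alpha sigma Z).

Let base_ge1 : 1 <= 1 + v * alpha / sigma ^+ 2.
Proof. by rewrite lerDl ltW// divr_gt0 ?mulr_gt0// exprn_gt0. Qed.

Let normalizer_gt0 : 0 < \sum_(1 <= b' < n.+1) n%:R `^ (- lambda * b'.-1%:R)
  :> R.
Proof.
rewrite big_nat_recl//= ltr_wpDr// ?powR_gt0 ?ltr0n//.
by apply: sumr_ge0 => i _; exact: powR_ge0.
Qed.

Lemma posterior_weight_gt0 y B : simple_partition B -> 0 < weight y B.
Proof.
move=> Bs; rewrite /posterior_weight /block_prior /block_number_pmf.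
rewrite !mulr_gt0 ?expR_gt0 ?powR_gt0 ?invr_gt0 ?ltr0n//.
- rewrite bin_gt0 -ltnS !prednK ?card_blocks_le//.
  exact: card_blocks_gt0.
- by rewrite (lt_le_trans _ base_ge1).
Qed.

(** The normaliser of the prior cancels in the ratio of weights. The powers of
    [1 + v * alpha / sigma ^+ 2] only help, since the base is at least 1 and [B] has no fewer blocks
    than [B0]. *)
Lemma posterior_weight_le (q : R) y B B0 :
  simple_partition B -> simple_partition B0 -> (#|B0| <= #|B|)%N ->
  residual Z y B0 - residual Z y B <= q ->
  weight y B <= 'C(n.-1, #|B0|.-1)%:R *
    ('C(n.-1, #|B|.-1)%:R^-1 * n%:R `^ (- lambda * (#|B|%:R - #|B0|%:R)))
    * expR (alpha / (2 * sigma ^+ 2) * q) * weight y B0.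
Proof.
move=> Bs B0s B0B qE; rewrite /posterior_weight /block_prior /block_number_pmf.
have b0_gt0 := card_blocks_gt0 n_gt0 B0s;
  have b_gt0 := card_blocks_gt0 n_gt0 Bs.
set N := \sum_(1 <= _ < _) _.
set c := 'C(n.-1, #|B|.-1)%:R; set c0 := 'C(n.-1, #|B0|.-1)%:R.
have c0_gt0 : 0 < c0 :> R.
  by rewrite ltr0n bin_gt0 -ltnS !prednK ?card_blocks_le.
have -> : n%:R `^ (- lambda * #|B|.-1%:R) =
    n%:R `^ (- lambda * (#|B|%:R - #|B0|%:R)) * n%:R `^ (- lambda *
      #|B0|.-1%:R) :> R.
  rewrite -powRD; last by rewrite pnatr_eq0 -lt0n n_gt0 implybT.
  have predE m : (0 < m)%N -> m.-1%:R = m%:R - 1 :> R.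
    by move=> m_gt0; rewrite -subn1 natrB.
  by congr (_ `^ _); rewrite !predE//; ring.
set p := _ `^ _; set p0 := n%:R `^ _.
set w := _ `^ _; set w0 := _ `^ _.
have ww0 : w <= w0.
  apply: ler_powR => //; rewrite !mulNr lerN2 ler_wpM2r ?invr_ge0 ?ler0n//.
  by rewrite ler_nat leq_mul2l B0B orbT.
have ee : expR (- (alpha / (2 * sigma ^+ 2)) * residual Z y B) <=
    expR (alpha / (2 * sigma ^+ 2) * q)
    * expR (- (alpha / (2 * sigma ^+ 2)) * residual Z y B0).
  rewrite -expRD ler_expR !mulNr -mulrBr -mulrN.
  apply: ler_wpM2l; first by rewrite divr_ge0 ?mulr_ge0 ?sqr_ge0// ltW.
  by rewrite lerBrDr; rewrite addrC.
have N0 := normalizer_gt0; rewrite -/N in N0.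
set e := expR _ in ee *; set eq := expR _ in ee *; set e0 := expR _ in ee *.
rewrite [leRHS](_ : _ = c^-1 * (p * p0 / N) * w0 * (eq * e0)); last first.
  by set ci := c^-1; field; rewrite !gt_eqF.
have pr0 : 0 <= c^-1 * (p * p0 / N).
  by rewrite !mulr_ge0 ?invr_ge0 ?ler0n ?powR_ge0// ltW.
apply: ler_pM => //; [by rewrite mulr_ge0// powR_ge0|exact: expR_ge0|].
exact: ler_wpM2l.
Qed.

Lemma posterior_le y B0 (E : pred {set {set 'I_n}}) : simple_partition B0 ->
  posterior lambda v alpha sigma Z y E <=
  \sum_(B | simple_partition B && E B) weight y B / weight y B0.
Proof.
move=> B0s; rewrite /posterior -mulr_suml.
have w0 B : simple_partition B -> 0 <= weight y B.
  by move=> Bs; exact/ltW/posterior_weight_gt0.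
apply: ler_wpM2l; first by apply: sumr_ge0 => B /andP[/w0].
have w00 := posterior_weight_gt0 y B0s.
have le0 : weight y B0 <= \sum_(B | simple_partition B) weight y B.
  by rewrite (bigD1 B0)//= lerDl sumr_ge0// => B /andP[/w0].
by rewrite lef_pV2// posrE ?(lt_le_trans w00).
Qed.

End Posterior.

(** * Measurability and expectation of the posterior *)

Lemma measurable_inv_gt0 d (T : measurableType d) (R : realType) (f : T -> R) :
  measurable_fun setT f -> (forall x, 0 < f x) ->
  measurable_fun setT (fun x => (f x)^-1).
Proof.
move=> mf f0; rewrite (_ : (fun x => _) = fun x => expR (- ln (f x))).
  apply: measurableT_comp => //; apply: measurableT_comp => //.
  by apply: measurableT_comp => //; exact: measurable_ln.
by apply/funext => x; rewrite expRN lnK ?posrE.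
Qed.

Lemma measurable_posterior d (T : measurableType d) (R : realType) (n K : nat)
    (lambda v alpha sigma : R) (Z : 'M[R]_(n, K.+1)) (y : T -> 'cV[R]_n)
    (B0 : {set {set 'I_n}}) (E : pred {set {set 'I_n}}) :
  (0 < n)%N -> 0 < sigma -> 0 < v -> 0 < alpha -> simple_partition B0 ->
  (forall j, measurable_fun setT (fun w => y w j 0)) ->
  measurable_fun setT (fun w => posterior lambda v alpha sigma Z (y w) E).
Proof.
move=> n0 s0 v0 a0 B0s my.
have mw B : measurable_fun setT
    (fun w => posterior_weight lambda v alpha sigma Z (y w) B).
  apply: measurable_funM => //; apply: measurableT_comp => //.
  apply: measurable_funM => //.
  under eq_fun do rewrite /residual -big_filter.
  apply: measurable_sum => S; apply: measurable_sqnorm => i.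
  apply: measurable_lin => j; under eq_fun do rewrite /sub_rows mxE.
  exact: my.
apply: measurable_funM.
  by under eq_fun do rewrite -big_filter; exact: measurable_sum.
apply: measurable_inv_gt0 => [|w].
  by under eq_fun do rewrite -big_filter; exact: measurable_sum.
have w0 B := @posterior_weight_gt0 R n K lambda v alpha sigma Z n0 s0 v0 a0
  (y w) B.
rewrite (bigD1 B0)//= ltr_wpDr ?w0//.
by apply: sumr_ge0 => B /andP[/w0/ltW].
Qed.

(** Integrating out the noise leaves a deterministic sum over the number of blocks. The event [E]
    must force at least as many blocks as [B0] for [posterior_weight_le] to apply. *)
Lemma posterior_expectation_le d (T : measurableType d) (R : realType)
    (P : probability T R) (n K : nat) (lambda v alpha sigma : R)
    (Z : 'M[R]_(n, K.+1)) (theta : 'cV[R]_n) (B0 : {set {set 'I_n}})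
    (E : pred nat) (Y : 'I_n -> {RV P >-> R}) :
  (0 < n)%N -> 0 < sigma -> 0 < v -> 0 < alpha < 1 ->
  simple_partition B0 -> piecewise_poly K B0 theta -> design_basis Z ->
  isotropic_gaussian theta sigma Y ->
  (forall b, E b -> (#|B0| <= b)%N) ->
  ('E_P[fun w => posterior lambda v alpha sigma Z (\col_i Y i w)
          (fun B => E #|B|)] <=
   ('C(n.-1, #|B0|.-1)%:R * \sum_(b < n.+1 | E b)
      n%:R `^ (- lambda * (b%:R - #|B0|%:R))
      * ((Num.sqrt (1 - alpha))^-1 ^+ K.+1) ^+ b)%:E)%E.
Proof.
move=> n0 s0 v0 /andP[a0 a1] B0s pw Zb Yg EB0.
have /andP[B0p _] := B0s.
have w0 y B := @posterior_weight_gt0 R n K lambda v alpha sigma Z n0 s0 v0 a0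
  y B.
(* The implication sits inside the existential so that [choice] yields a projection for every [B],
   simple partition or not. *)
have QP (B : {set {set 'I_n}}) : exists Q : 'M[R]_n, simple_partition B ->
    [/\ is_proj Q, (\rank Q <= K.+1 * #|B|)%N &
    forall y, residual Z y B0 - residual Z y B <= sqnorm (Q *m (y - theta))].
  have [Bs|] := boolP (simple_partition B); last by exists 0.
  have /andP[Bp _] := Bs.
  by have [Q ?] := residual_excess Bp B0p Zb pw; exists Q.
have [Q QE] := choice QP.
set A := (Num.sqrt (1 - alpha))^-1 ^+ K.+1.
have A0 : 0 <= A by rewrite exprn_ge0// invr_ge0.
pose eps w : 'cV[R]_n := \col_i Y i w - theta.
pose coef b : R := 'C(n.-1, #|B0|.-1)%:R *
    ('C(n.-1, b.-1)%:R^-1 * n%:R `^ (- lambda * (b%:R - #|B0|%:R))).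
have coef0 b : 0 <= coef b.
  by rewrite !mulr_ge0 ?invr_ge0 ?ler0n ?powR_ge0.
pose h (B : {set {set 'I_n}}) w := expR (alpha / (2 * sigma ^+ 2) * sqnorm (Q
  B *m eps w)).
have mh B : measurable_fun setT (h B).
  apply: measurableT_comp => //; apply: measurable_funM => //.
  apply: measurable_sqnorm => i; apply: measurable_lin => j.
  by under eq_fun do rewrite !mxE; exact: measurable_funB.
rewrite unlock.
apply: (@le_trans _ _ (\int[P]_w (\sum_(B : {set {set 'I_n}} |
    simple_partition B && E #|B|) (coef #|B| * h B w)%:E))%E).
  apply: ge0_le_integral => //.
  - move=> w _; rewrite lee_fin /posterior divr_ge0//; apply: sumr_ge0 => B.
      by move=> /andP[/w0/ltW].
    by move=> /w0/ltW.
  - apply/measurable_EFinP; apply: (@measurable_posterior _ _ _ _ _ _ _ _ _ _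
      (fun w => \col_i Y i w) _ _ n0 s0 v0 a0 B0s) => j.
    by under eq_fun do rewrite mxE; exact: measurable_funPT.
  - under eq_fun do rewrite -big_filter.
    by apply: emeasurable_sum => B; apply/measurable_EFinP/measurable_funM.
  move=> w _; rewrite sumEFin lee_fin.
  apply: (le_trans (posterior_le _ n0 s0 v0 a0 _ _ B0s)).
  apply: ler_sum => B /andP[Bs EB].
  rewrite ler_pdivrMr ?w0//.
  have [_ _ QB] := QE B Bs.
  by apply: posterior_weight_le => //; exact: EB0.
under eq_integral do rewrite -big_filter.
rewrite ge0_integral_sum//; last 2 first.
- by move=> B; apply/measurable_EFinP/measurable_funM.
- by move=> B w _; rewrite lee_fin mulr_ge0// expR_ge0.
rewrite big_filter.
apply: (@le_trans _ _ (\sum_(B : {set {set 'I_n}} |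
    simple_partition B && E #|B|) (coef #|B| * A ^+ #|B|)%:E)%E).
  apply: lee_sum => B /andP[Bs _]; under eq_integral do rewrite EFinM.
  rewrite ge0_integralZl_EFin//; last 2 first.
  - by move=> w _; rewrite lee_fin expR_ge0.
  - exact/measurable_EFinP.
  rewrite [leRHS]EFinM lee_wpmul2l ?lee_fin// /A -exprM.
  have [Qp Qr _] := QE B Bs.
  by apply: (gaussian_projection_mgf s0 Yg) => //; rewrite (ltW a0).
rewrite sumEFin lee_fin.
under eq_bigr do rewrite /coef -!mulrA.
rewrite -mulr_sumr ler_wpM2l//.
apply: (@sum_simple_partition_le _ _ E
  (fun b => n%:R `^ (- lambda * (b%:R - #|B0|%:R)) * A ^+ b)) => // b.
by rewrite mulr_ge0 ?powR_ge0// exprn_ge0.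
Qed.

(** * The tail sum and the choice of constants *)

Lemma bin_le_exp (m k : nat) : ('C(m, k) <= m ^ k)%N.
Proof.
elim: k => [|k IH]; first by rewrite bin0.
rewrite (@leq_trans (k.+1 * 'C(m, k.+1)))// ?leq_pmull//.
by rewrite mul_bin_left expnS leq_mul// leq_subr.
Qed.

(** With L = ln n, the total exponent is at most b0 (C ln A - 2 G L). The first condition on [ln A]
    makes the terms nonincreasing in [b]; the second spends one G L on C ln A and leaves the other
    as the rate. *)
Lemma tail_sum_le (R : realType) (lambda C A : R) (n b0 : nat) :
  0 < lambda -> 1 + lambda^-1 < C -> 1 <= A -> (0 < n)%N -> (0 < b0)%N ->
  let G := (lambda * C - lambda - 1) / 2 in
  ln A <= lambda * ln n%:R -> C * ln A <= G * ln n%:R ->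
  'C(n.-1, b0.-1)%:R * (\sum_(b < n.+1 | (C * b0%:R < b%:R)%R)
      n%:R `^ (- lambda * (b%:R - b0%:R)) * A ^+ b)
  <= expR (- G * b0%:R * ln n%:R).
Proof.
move=> l0 lC A1 n0 b00 G hA1 hA2.
set L := ln n%:R in hA1 hA2 *.
have nE : n%:R = expR L :> R by rewrite lnK// posrE ltr0n.
have A0 : 0 < A by rewrite (lt_le_trans _ A1).
have C1 : 1 < C by rewrite (lt_trans _ lC)// ltrDl invr_gt0.
have b0R : 1 <= b0%:R :> R by rewrite ler1n.
have L0 : 0 <= L by rewrite ln_ge0// ler1n.
(* The value of a term at b = C b0, which bounds all terms of the sum. *)
pose M := expR (lambda * b0%:R * L - C * b0%:R * (lambda * L - ln A)).
have sumM : \sum_(b < n.+1 | (C * b0%:R < b%:R)%R)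
      n%:R `^ (- lambda * (b%:R - b0%:R)) * A ^+ b <= n%:R * M.
  (* The index 0 fails the strict inequality, so at most [n] terms remain. Their number supplies the
     factor [n] that completes the bound n^(b0 - 1) on the binomial to n^b0. *)
  rewrite big_mkcond big_ord_recl/= ifF; last first.
    by apply/negbTE; rewrite -leNgt mulr_ge0 ?ler0n// ltW// (lt_trans _ C1).
  apply: (@le_trans _ _ (\sum_(i < n) M)); last first.
    by rewrite sumr_const card_ord [leRHS]mulr_natl lexx.
  rewrite add0r; apply: ler_sum => i _; set b := bump 0 i.
  case: ifPn => Cb; last exact: expR_ge0.
  rewrite /powR pnatr_eq0 gtn_eqF// -/L -[A in A ^+ _]lnK ?posrE//.
  rewrite -expRM_natl -expRD ler_expR.
  have : C * b0%:R * (lambda * L - ln A) <= b%:R * (lambda * L - ln A).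
    by apply: ler_wpM2r; [rewrite subr_ge0|exact: ltW].
  set X := ln A; lra.
have binM : 'C(n.-1, b0.-1)%:R <= expR ((b0%:R - 1) * L).
  apply: (@le_trans _ _ ((n ^ b0.-1)%N%:R)).
    by rewrite ler_nat (leq_trans _ (bin_le_exp _ _))// leq_bin2l// leq_pred.
  rewrite natrX nE -expRM_natl ler_expR -subn1 natrB//.
apply: (le_trans (ler_pM (ler0n _ _) _ binM sumM)).
  by apply: sumr_ge0 => b _; rewrite mulr_ge0 ?powR_ge0// exprn_ge0// ltW.
rewrite /M nE -!expRD ler_expR.
have : b0%:R * (C * ln A) <= b0%:R * (G * L) by apply: ler_wpM2l.
rewrite /G; set X := ln A.
nra.
Qed.

Theorem theorem3 (R : realType) (K : nat) (sigma lambda v alpha : R)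
    (b : nat -> R) (C : R) :
  0 < sigma -> 0 < lambda -> 0 < v -> 0 < alpha < 1 ->
  (fun n => b n / n%:R) @ \oo --> (0 : R) ->
  1 + lambda^-1 < C ->
  exists G C0 : R, [/\ 0 < G, 0 < C0 &
    \forall n \near \oo,
      forall (theta : 'cV[R]_n) (Btheta : {set {set 'I_n}})
        (Z : 'M[R]_(n, K.+1))
        (d : measure_display) (T : measurableType d) (P : probability T R)
        (Y : 'I_n -> {RV P >-> R}),
      Theta K (b n) theta ->
      most_economical K theta Btheta ->
      design_basis Z ->
      isotropic_gaussian theta sigma Y ->
      ('E_P[fun w => posterior lambda v alpha sigma Z (\col_i Y i w)
              (fun B => C * #|Btheta|%:R < #|B|%:R)%R]
       <= (C0 * expR (- G * #|Btheta|%:R * ln n%:R))%:E)%E].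
Proof.
move=> s0 l0 v0 a01 _ lC.
have [a0 a1] := andP a01.
(* Half of the margin by which lambda C exceeds 1 + lambda. *)
pose G := (lambda * C - lambda - 1) / 2.
have G0 : 0 < G.
  rewrite divr_gt0// -addrA -opprD subr_gt0.
  by rewrite -(ltr_pM2l l0) mulrDr mulr1 divff ?gt_eqF// in lC.
pose A := (Num.sqrt (1 - alpha))^-1 ^+ K.+1.
have b0 : 0 < 1 - alpha by rewrite subr_gt0.
have A1 : 1 <= A.
  rewrite exprn_ege1// invf_ge1 ?sqrtr_gt0// -[leRHS]sqrtr1 ler_sqrt//.
  by rewrite lerBlDr lerDl ltW.
have C1 : 1 < C by rewrite (lt_trans _ lC)// ltrDl invr_gt0.
exists G, 1; split => //.
(* Once ln n reaches [M], both conditions of [tail_sum_le] hold; [M] depends only on [alpha], [K],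
   [lambda] and [C], whence the uniformity in [theta]. *)
pose M := Num.max (ln A / lambda) (C * ln A / G).
near=> n.
have n0 : (0 < n)%N by near: n; exact: nbhs_infty_gt.
have Mn : M <= ln n%:R.
  rewrite -[M]expRK ler_ln ?posrE ?expR_gt0 ?ltr0n//.
  by near: n; exact: nbhs_infty_ger.
have /andP[hA1 hA2] : (ln A <= lambda * ln n%:R) && (C * ln A <= G * ln n%:R).
  by move: Mn; rewrite ge_max !ler_pdivrMr// ![ln n%:R * _]mulrC.
move=> theta B0 Z d T P Y _ [B0s pw _] Zb Yg.
have b00 := card_blocks_gt0 n0 B0s.
apply: (le_trans (posterior_expectation_le lambda
  (E := fun b => (C * #|B0|%:R < b%:R)%R) n0 s0 v0 a01 B0s pw Zb Yg _)).
  move=> m /ltW Cb; rewrite -(ler_nat R) (le_trans _ Cb)//.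
  by rewrite ler_peMl// ltW.
by rewrite lee_fin mul1r tail_sum_le.
Unshelve. all: by end_near. Qed.
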